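(* Let $(B,D)$ be a pair consisting of an open bounded set $B\subseteq\mathbb{R}^n$ containing $0$ and a group of dilations $D=\{\delta_r:r>0\}$, $\delta_r(x_1,\dots,x_n)=(r^{\lambda_1}x_1,\dots,r^{\lambda_n}x_n)$ with $\lambda_1,\dots,\lambda_n>0$, and let $A=\lambda_1+\dots+\lambda_n$. Suppose that there is a radius function $R$ on $B$ with constant $K$ (as defined in the context). Let $C>0$ and $0<p<1$. Then there exists a constant $\tilde C_p$ such that $f\in S(B,D,C)$ implies $f^p\in S(B,D,\tilde C_p)$. That is, whenever $\Omega\subseteq\mathbb{R}^n$ is open and $f:\Omega\to\mathbb{R}$ is a locally bounded, non-negative measurable function with $$f(a)\leq\frac{C}{r^A}\int_{B_r(a)}f(x)\,dx\quad\text{whenever }\overline{B_r(a)}\subseteq\Omega,$$ then also $$f(a)^p\leq\frac{\tilde C_p}{r^A}\int_{B_r(a)}f(x)^p\,dx\quad\text{whenever }\overline{B_r(a)}\subseteq\Omega.$$ Moreover, one can take $\tilde C_p=2R(0)^{-A}(2K^A)^{(1-p)/p}C$.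
   Context: For $r>0$ and $a\in\mathbb{R}^n$, put $B_r=\delta_r(B)$ and $B_r(a)=a+B_r$ (the ''ball of radius $r$ at $a$''). Radius function: a bounded, positive, measurable function $R$ on $B$ such that $\overline{B_{R(a)}(a)}\subseteq B$ for every $a\in B$, and such that there is a constant $K$, independent of $a$ and $x$, with $R(a)/R(x)\leq K$ whenever $a\in B$ and $x\in\overline{B_{R(a)}(a)}$. For $C>0$, $S(B,D,C)$ is the set of all locally bounded non-negative (measurable) functions $f$, each defined on some open subset $\Omega$ of $\mathbb{R}^n$ (which may vary with $f$), such that $f(a)\leq\frac{C}{r^A}\int_{B_r(a)}f(x)\,dx$ whenever $a\in\mathbb{R}^n$, $r>0$ and $\overline{B_r(a)}\subseteq\Omega$. *)

(* Defs.v *)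
(* R^n is 'rV[R]_n. *)
From HB Require Import structures.
From mathcomp Require Import all_boot all_order all_algebra.
From mathcomp Require Import all_classical all_reals all_analysis.

Set Implicit Arguments.
Unset Strict Implicit.
Unset Printing Implicit Defensive.

Import Order.TTheory GRing.Theory Num.Theory.
Import numFieldNormedType.Exports.

Local Open Scope classical_set_scope.
Local Open Scope ring_scope.

(* The library has no Lebesgue measure on R^n. It is defined here as the
   restriction of the Lebesgue outer measure to its Caratheodory-measurable
   sets, i.e. to the Lebesgue-measurable sets. *)
Section lebesgue_measure_rV.
Context (R : realType) (n : nat).
Local Open Scope ereal_scope.

Definition rV_box (b : 'rV[R]_n * 'rV[R]_n) : set 'rV[R]_n :=
  [set x | forall i, (b.1 0%R i < x 0%R i <= b.2 0%R i)%R].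

(* A factor is 0 when b.2 i <= b.1 i, in which case the box is empty. *)
Definition rV_box_volume (b : 'rV[R]_n * 'rV[R]_n) : R :=
  (\prod_i Num.max 0 (b.2 0 i - b.1 0 i))%R.

(* Covers are indexed by a subset D of nat, so that finite and empty covers are
   allowed: for n = 0 no box is empty. *)
Definition lebesgue_outer (A : set 'rV[R]_n) : \bar R :=
  ereal_inf [set v | exists (D : set nat) (b : nat -> 'rV[R]_n * 'rV[R]_n),
    A `<=` \bigcup_(k in D) rV_box (b k) /\
    v = \esum_(k in D) (rV_box_volume (b k))%:E].

Lemma rV_box_volume_ge0 b : (0 <= rV_box_volume b)%R.
Proof. by apply: prodr_ge0 => i _; rewrite le_max lexx. Qed.

Lemma lebesgue_outer_ge0 A : 0 <= lebesgue_outer A.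
Proof.
apply: le_ereal_inf_tmp => _ [D [b [_ ->]]].
by apply: esum_ge0 => k _; rewrite lee_fin rV_box_volume_ge0.
Qed.

Lemma lebesgue_outer0 : lebesgue_outer set0 = 0.
Proof.
apply/eqP; rewrite eq_le lebesgue_outer_ge0 andbT; apply: ereal_inf_lbound.
by exists set0, (fun=> (0%R, 0%R)); split => //; rewrite esum_set0.
Qed.

Lemma le_lebesgue_outer :
  {homo lebesgue_outer : A B / A `<=` B >-> A <= B}.
Proof.
move=> A B AB; apply: ereal_inf_le_tmp => _ [D [b [BD ->]]].
by exists D, b; split => //; exact: subset_trans BD.
Qed.

Lemma lebesgue_outer_sigma_subadditive : sigma_subadditive lebesgue_outer.
Proof.
move=> A; have [[i ioo]|] := pselect (exists i, lebesgue_outer (A i) = +oo).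
  rewrite (eseries_pinfty _ _ ioo) ?leey// => k _.
  by rewrite -ltNye (lt_le_trans _ (lebesgue_outer_ge0 _)).
rewrite -forallNE => Aoo.
suff add2e (e : {posnum R}) : lebesgue_outer (\bigcup_k A k) <=
    \sum_(i <oo) lebesgue_outer (A i) + e%:num%:E.
  by apply/lee_addgt0Pr => _/posnumP[].
rewrite (le_trans _ (epsilon_trick _ _ _))//; last first.
  by move=> k; exact: lebesgue_outer_ge0.
pose P k (c : set nat * (nat -> 'rV[R]_n * 'rV[R]_n)) :=
  A k `<=` \bigcup_(j in c.1) rV_box (c.2 j) /\
  \esum_(j in c.1) (rV_box_volume (c.2 j))%:E <=
    lebesgue_outer (A k) + (e%:num / (2 ^ k.+1)%:R)%:E.
have [G PG] : {G & forall k, P k (G k)}.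
  apply: (@choice _ _ P) => k.
  have fk : lebesgue_outer (A k) \is a fin_num.
    by rewrite ge0_fin_numE ?lebesgue_outer_ge0// ltey; apply/eqP.
  have e0 : (0 < e%:num / (2 ^ k.+1)%:R)%R by [].
  have [_ [D [b [AD ->]]] /ltW le_b] := lb_ereal_inf_adherent e0 fk.
  by exists (D, b).
have vol0 k j : 0 <= (rV_box_volume ((G k).2 j))%:E.
  by rewrite lee_fin rV_box_volume_ge0.
have /ppcard_eqP[f] := card_nat2.
pose g k : nat * nat := f^-1%FUN k.
have gf ij : g (f ij) = ij by rewrite /g funK ?inE.
have fg k : f (g k) = k by rewrite /g invK ?inE.
pose J : set (nat * nat) := [set: nat] `*`` (fun i => (G i).1).
pose D : set nat := g @^-1` J.
pose b k := (G (g k).1).2 (g k).2.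
apply: (@le_trans _ _ (\esum_(k in D) (rV_box_volume (b k))%:E)).
  apply: ereal_inf_lbound; exists D, b; split => // x [i _ Aix].
  have [j Gj xj] := (PG i).1 x Aix.
  by exists (f (i, j)); rewrite /D /b /= ?gf.
have -> : \esum_(k in D) (rV_box_volume (b k))%:E =
    \sum_(i <oo) \esum_(j in (G i).1) (rV_box_volume ((G i).2 j))%:E.
  rewrite nneseries_esumT; last by move=> i; exact: esum_ge0.
  rewrite esum_esum; last by move=> i j _ _; exact: vol0.
  apply/esym/(reindex_esum D J g (fun k => (rV_box_volume ((G k.1).2 k.2))%:E)).
  split => [k //|k1 k2 _ _ gE|ij Jij].
  - by rewrite -(fg k1) gE fg.
  - by exists (f ij); rewrite /D /= gf.
apply: lee_nneseries => [i _ _|i _]; first exact: esum_ge0.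
exact: (PG i).2.
Qed.

HB.instance Definition _ := isOuterMeasure.Build R 'rV[R]_n lebesgue_outer
  lebesgue_outer0 lebesgue_outer_ge0 le_lebesgue_outer
  lebesgue_outer_sigma_subadditive.

Definition lebesgue_rV := caratheodory_type lebesgue_outer.

HB.instance Definition _ := Measurable.on lebesgue_rV.

Definition lebesgue_measure_rV : set lebesgue_rV -> \bar R := lebesgue_outer.

HB.instance Definition _ := isMeasure.Build _ lebesgue_rV R lebesgue_measure_rV
  (@caratheodory_measure0 R 'rV[R]_n lebesgue_outer)
  (@caratheodory_measure_ge0 R 'rV[R]_n lebesgue_outer)
  (@caratheodory_measure_sigma_additive R 'rV[R]_n lebesgue_outer).

End lebesgue_measure_rV.

Section dilations.
Context (R : realType) (n : nat).
Implicit Types (B Omega : set 'rV[R]_n) (lam : 'I_n -> R).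

Definition dilation lam (r : R) (x : 'rV[R]_n) : 'rV[R]_n :=
  \row_i (r `^ lam i * x 0 i).

Definition dball B lam (r : R) (a : 'rV[R]_n) : set 'rV[R]_n :=
  [set a + y | y in dilation lam r @` B].

Definition homogeneous_dim lam : R := \sum_i lam i.

(* Only the values of rho on B matter. *)
Definition radius_function B lam (rho : 'rV[R]_n -> R) (K : R) : Prop :=
  [/\ [bounded rho a | a in B],
      (forall a, B a -> 0 < rho a),
      measurable_fun (B : set (lebesgue_rV R n)) (rho : lebesgue_rV R n -> R),
      (forall a, B a -> closure (dball B lam (rho a) a) `<=` B) &
      (forall a x, B a -> closure (dball B lam (rho a) a) x ->
        rho a / rho x <= K)].

(* f, restricted to its domain Omega, belongs to S(B, D, C); the values of f
   outside Omega are irrelevant. *)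
Definition in_S B lam (C : R) Omega (f : 'rV[R]_n -> R) : Prop :=
  [/\ open Omega,
      measurable_fun (Omega : set (lebesgue_rV R n)) (f : lebesgue_rV R n -> R),
      [locally [bounded f x | x in Omega]],
      (forall x, Omega x -> 0 <= f x) &
      (forall a r, 0 < r -> closure (dball B lam r a) `<=` Omega ->
        ((f a)%:E <= (C / r `^ homogeneous_dim lam)%:E *
          \int[@lebesgue_measure_rV R n]_(x in dball B lam r a) (f x)%:E)%E)].

End dilations.

(* Main.v *)
Require Import Defs.
From HB Require Import structures.
From mathcomp Require Import all_boot all_order all_algebra.
From mathcomp Require Import all_classical all_reals all_analysis.
From mathcomp Require Import measurable_realfun ring.

Set Implicit Arguments.
Unset Strict Implicit.
Unset Printing Implicit Defensive.

Import Order.TTheory GRing.Theory Num.Theory.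
Import numFieldNormedType.Exports.

Local Open Scope classical_set_scope.
Local Open Scope ring_scope.

(* Put s = A / p and let M be the supremum over x in B of
   u x = rho x ^ s * f (a + delta_r x), which is finite because f is bounded on
   the compact closure of B_r(a).  On the ball B_(r rho x)(a + delta_r x), which
   is the image under y |-> a + delta_r y of B_(rho x)(x), the radius function
   varies at most by the factor K, so f <= M (K / rho x) ^ s there.  Inserting
   f = f ^ (1 - p) f ^ p and this bound for f ^ (1 - p) into the mean value
   inequality on that ball makes all powers of rho x cancel and leaves
   u x <= C r ^ (-A) K ^ (s (1 - p)) M ^ (1 - p) * I, where I is the integral
   of f ^ p on B_r(a).
   Taking the supremum over x and dividing by M ^ (1 - p) bounds M ^ p, hence
   u 0 ^ p = rho 0 ^ A * f a ^ p. *)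

(** * Real powers, and boundedness on compact sets *)

Lemma powRV (R : realType) (x e : R) : 0 <= x -> x^-1 `^ e = (x `^ e)^-1.
Proof. by move=> x0; rewrite -powR_inv1// -powRrM mulN1r powRN. Qed.

(** This is the closing division by [M ^ (1 - p)]; at [M = 0] it holds because [0 ^ p = 0] for
    nonzero [p]. *)
Lemma ge0_le_powR_of_le_mul (R : realType) (M c p : R) :
  0 < p -> 0 <= M -> 0 <= c -> M <= c * M `^ (1 - p) -> M `^ p <= c.
Proof.
move=> p0; rewrite le_eqVlt => /predU1P[<-|M0] c0 Mc.
  by rewrite powR0// gt_eqF.
rewrite -(ler_pM2r (powR_gt0 (1 - p) M0)) -powRD; last first.
  by rewrite (gt_eqF M0) implybT.
by rewrite addrC subrK powRr1// ltW.
Qed.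

Lemma bounded_closure (R : realType) (V : normedModType R) (A : set V) :
  bounded_set A -> bounded_set (closure A).
Proof.
move=> /pinfty_ex_gt0[M M0 AM].
have cM : closed [set x : V | `|x| <= M].
  apply: (@closed_comp _ _ (@Num.norm _ V) [set y : R | y <= M]).
    by move=> x _; exact: norm_continuous.
  exact: closed_le.
rewrite /= /bounded_near; near=> N => x /(closureS AM).
rewrite -(iffLR (closure_id _) cM) => /le_trans.
by apply; near: N; apply: nbhs_pinfty_ge; exact: num_real.
Unshelve. all: by end_near. Qed.

(** Compactness is used in its near-covering form, with the bound [M] tending to [+oo] as the
    parameter, so no finite subcover is extracted. *)
Lemma compact_locally_bounded (R : realType) (T : topologicalType)
    (V : normedModType R) (f : T -> V) (D K : set T) :
  compact K -> K `<=` D -> [locally [bounded f x | x in D]] ->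
  [bounded f x | x in K].
Proof.
move=> /compact_near_coveringP cK KD fD.
have : \forall M \near +oo, K `<=` (fun x => D x -> `|f x| <= M).
  (* Only numbers strictly above [M0] are known to be bounds near [x], whence [M0 + 1]. *)
  apply: cK => x Kx; have [M0 [_ fM0]] := fD x (KD x Kx).
  exists ([set y | D y -> `|f y| <= M0 + 1], [set M | M0 + 1 <= M]) => /=.
    split; first by apply: fM0; rewrite ltrDl.
    by apply: nbhs_pinfty_ge; exact: num_real.
  by move=> [y M] [/= fy M0M] /fy /le_trans; exact.
by apply: filterS => M fM x /[dup] /fM + /KD; exact.
Qed.

(** * Comparison of integrals up to a factor *)

Section integral.
Context d (T : measurableType d) (R : realType).
Local Open Scope ereal_scope.
Import HBNNSimple.

(** If a simple function lies below [f] extended by 0 outside [D], then its multiple by [c^-1] lies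
    below [g] extended by 0 outside [E]. The bound thus passes directly to the suprema that define
    the integrals. *)
Lemma ge0_le_integralZ (mu : {measure set T -> \bar R}) (D E : set T)
    (f g : T -> \bar R) (c : R) : (0 < c)%R -> D `<=` E ->
  (forall x, D x -> 0 <= f x) -> (forall x, E x -> 0 <= g x) ->
  (forall x, D x -> f x <= c%:E * g x) ->
  \int[mu]_(x in D) f x <= c%:E * \int[mu]_(x in E) g x.
Proof.
move=> c0 DE f0 g0 fg; rewrite !ge0_integralE//.
apply: ge_ereal_sup => _ [h /= hf <-].
have ic0 : (0 <= c^-1)%R by rewrite invr_ge0 ltW.
rewrite -lee_pdivrMl// -sintegralrM.
apply: ereal_sup_ubound; exists (scale_nnsfun h ic0) => //= x.
rewrite EFinM lee_pdivrMl//; apply: (le_trans (hf x)).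
rewrite /patch; case: ifPn; first by rewrite inE => /[dup] /DE /mem_set -> /fg.
by case: ifPn; rewrite ?mule0// inE => Ex _; rewrite mule_ge0 ?g0// lee_fin ltW.
Qed.

End integral.

(** * Dilations and their balls *)

Section dilations.
Context (R : realType) (n : nat) (lam : 'I_n -> R).
Implicit Types (B : set 'rV[R]_n) (x y : 'rV[R]_n).

Lemma dilation0 r : dilation lam r 0 = 0.
Proof. by apply/rowP => i; rewrite !mxE mulr0. Qed.

Lemma dilationD r x y :
  dilation lam r (x + y) = dilation lam r x + dilation lam r y.
Proof. by apply/rowP => i; rewrite !mxE mulrDr. Qed.

Lemma dilationM r s x : 0 <= r -> 0 <= s ->
  dilation lam (r * s) x = dilation lam r (dilation lam s x).
Proof. by move=> r0 s0; apply/rowP => i; rewrite !mxE powRM// mulrA. Qed.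

Lemma norm_dilation_le r x :
  `|dilation lam r x| <= (\sum_i r `^ lam i) * `|x|.
Proof.
have s0 : 0 <= \sum_i r `^ lam i by apply: sumr_ge0 => i _; exact: powR_ge0.
rewrite [leLHS]/Num.norm/= mx_normrE; apply/bigmax_leP; split=> [|[i j] _ /=].
  by rewrite mulr_ge0.
rewrite mxE normrM ger0_norm ?powR_ge0//; apply: ler_pM; rewrite ?powR_ge0//.
  by rewrite (bigD1 j)//= lerDl sumr_ge0// => k _; exact: powR_ge0.
by rewrite [leRHS]/Num.norm/= mx_normrE (le_bigmax _ _ (0, j)).
Qed.

Lemma bounded_dball B r a : bounded_set B -> bounded_set (dball B lam r a).
Proof.
move=> /pinfty_ex_gt0[M M0 BM].
rewrite /= /bounded_near; near=> N => _ [_ [x Bx <-] <-] /=.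
apply: (le_trans (ler_normD _ _)).
apply: (@le_trans _ _ (`|a| + (\sum_i r `^ lam i) * M)).
  rewrite lerD2l (le_trans (norm_dilation_le _ _))// ler_wpM2l ?BM//.
  by apply: sumr_ge0 => i _; exact: powR_ge0.
by near: N; apply: nbhs_pinfty_ge; exact: num_real.
Unshelve. all: by end_near. Qed.

(** Dilations are additive and compose by multiplying radii. With [s = rho x], the inclusion of
    [B_s(x)] in [B] becomes the inclusion of the image ball in [B_r(a)]. *)
Lemma dball_dilation B r s a x : 0 <= r -> 0 <= s ->
  dball B lam (r * s) (a + dilation lam r x) =
  [set a + dilation lam r y | y in dball B lam s x].
Proof.
move=> r0 s0; apply/seteqP.
split => [_ [_ [b Bb <-] <-]|_ [_ [_ [b Bb <-] <-] <-]].
  exists (x + dilation lam s b).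
    by exists (dilation lam s b) => //; exists b.
  by rewrite dilationD dilationM// addrA.
exists (dilation lam (r * s) b); first by exists b.
by rewrite dilationD dilationM// addrA.
Qed.

End dilations.

(** * The mean value inequality for powers *)

Section mean_value.
Context (R : realType) (n : nat) (B : set 'rV[R]_n) (lam : 'I_n -> R).
Context (rho : 'rV[R]_n -> R) (K : R).
Hypotheses (bndB : bounded_set B) (B0 : B 0) (lam0 : forall i, 0 < lam i).
Hypothesis rhoK : radius_function B lam rho K.
Let A := homogeneous_dim lam.

(** Take both points of the ratio bound to be 0: the ratio is then 1. *)
Lemma radius_function_ge1 : 1 <= K.
Proof.
case: rhoK => _ rho0 _ _ /(_ 0 0 B0); rewrite divff ?gt_eqF ?rho0//; apply.
apply: subset_closure; exists 0; last by rewrite add0r.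
by exists 0 => //; exact: dilation0.
Qed.

(** The constant carries no factor 2: the estimate of [u x] holds at every [x] of [B], so the
    supremum is taken directly, without choosing a point where [u] nearly attains it. *)
Lemma mean_value_powR (C p : R) (Omega : set 'rV[R]_n) (f : 'rV[R]_n -> R)
    (a : 'rV[R]_n) (r : R) : 0 < C -> 0 < p -> p < 1 ->
  in_S B lam C Omega f -> 0 < r -> closure (dball B lam r a) `<=` Omega ->
  ((f a `^ p)%:E <=
   (rho 0 `^ (- A) * K `^ (A * ((1 - p) / p)) * C / r `^ A)%:E *
   \int[@lebesgue_measure_rV R n]_(x in dball B lam r a) (f x `^ p)%:E)%E.
Proof.
move=> C0 p0 p1 [oO mf locf f0 Sf] r0 clO.
pose s := A / p; have s0 : 0 <= s.
  by apply: divr_ge0; [apply: sumr_ge0 => i _|]; exact: ltW.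
have K1 := radius_function_ge1; have K0 : 0 < K := lt_le_trans ltr01 K1.
case: rhoK => bndrho rho0 _ clB rhoK_le.
have DO : dball B lam r a `<=` Omega.
  by apply: subset_trans clO; exact: subset_closure.
have D_B x : B x -> dball B lam r a (a + dilation lam r x).
  by move=> Bx; exists (dilation lam r x) => //; exists x.
have Da : dball B lam r a a by have := D_B 0 B0; rewrite dilation0 addr0.
set I := (\int[_]_(_ in _) _)%E.
have I0 : (0 <= I)%E by apply: integral_ge0 => x _; rewrite lee_fin powR_ge0.
pose u x := rho x `^ s * f (a + dilation lam r x).
have u_ge0 x : B x -> 0 <= u x.
  by move=> Bx; rewrite mulr_ge0 ?powR_ge0// f0//; exact/DO/D_B.
(* Since [s p = A], one has [s = A + s (1 - p)]. For [t = rho x] the first factor will cancel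
   against [(r t) ^ A], the second against the power of [t] in [k]. *)
have powR_s t : 0 < t -> t `^ s = t `^ A * t `^ (s * (1 - p)).
  move=> t0; rewrite -powRD; last by rewrite (gt_eqF t0) implybT.
  by congr powR; rewrite /s; field; rewrite gt_eqF.
have ub_u : has_ubound [set u x | x in B].
  have [N N0 fN] : exists2 N, 0 < N &
      closure (dball B lam r a) `<=` [set x | `|f x| <= N].
    apply: pinfty_ex_gt0; apply: (compact_locally_bounded _ clO locf).
    apply: bounded_closed_compact; last exact: closed_closure.
    exact/bounded_closure/bounded_dball.
  have [P P0 rhoP] := pinfty_ex_gt0 bndrho.
  exists (P `^ s * N) => _ [x Bx <-].
  apply: ler_pM; rewrite ?powR_ge0//.
  - exact/f0/DO/D_B.
  - apply: ge0_ler_powR; rewrite ?nnegrE ?(ltW P0) ?(ltW (rho0 x Bx))//.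
    by apply: (le_trans (ler_norm _)); exact: rhoP.
  - by apply: (le_trans (ler_norm _)); apply: fN; exact/subset_closure/D_B.
pose M := sup [set u x | x in B].
have u_le x : B x -> u x <= M by move=> Bx; apply: ub_le_sup => //; exists x.
have M0 : 0 <= M := le_trans (u_ge0 0 B0) (u_le 0 B0).
pose c := C / r `^ A * K `^ (s * (1 - p)).
have c0 : 0 < c by rewrite mulr_gt0 ?divr_gt0 ?powR_gt0.
(* Positivity of [M] makes [k] positive, as [ge0_le_integralZ] requires; [M = 0] is treated
   separately. *)
have u_int x : 0 < M -> B x -> ((u x)%:E <= (c * M `^ (1 - p))%:E * I)%E.
  move=> M_gt0 Bx; set t := rho x; have t0 : 0 < t by exact: rho0.
  pose k := (M * (K / t) `^ s) `^ (1 - p).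
  have k0 : 0 < k by rewrite powR_gt0// mulr_gt0// powR_gt0// divr_gt0.
  have ballE := dball_dilation lam B a x (ltW r0) (ltW t0).
  have subB : dball B lam t x `<=` B.
    by apply: subset_trans (clB x Bx); exact: subset_closure.
  have sub : dball B lam (r * t) (a + dilation lam r x) `<=` dball B lam r a.
    by rewrite ballE => _ [w xw <-]; exact/D_B/subB.
  have f_le z : dball B lam (r * t) (a + dilation lam r x) z ->
      f z <= k * f z `^ p.
    rewrite ballE => -[w xw <-]; have Bw := subB w xw.
    set v := f _; have v0 : 0 <= v by rewrite f0//; exact/DO/D_B.
    (* From [u w <= M] comes [v <= M (1 / rho w) ^ s], and [t <= K rho w] gives
       [1 / rho w <= K / t]. *)
    have vM : v <= M * (K / t) `^ s.
      have w0 := rho0 w Bw.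
      have tw : t <= K * rho w.
        by rewrite -ler_pdivrMr// rhoK_le//; exact: subset_closure.
      apply: (@le_trans _ _ (M * (rho w)^-1 `^ s)).
        by rewrite (powRV _ (ltW w0)) ler_pdivlMr ?powR_gt0// mulrC u_le.
      rewrite ler_wpM2l// ge0_ler_powR ?s0 ?nnegrE ?invr_ge0 ?divr_ge0//.
      1-3: exact: ltW.
      by rewrite ler_pdivlMr// mulrC ler_pdivrMr.
    (* Splitting [v = v ^ (1 - p) * v ^ p] is valid even at [v = 0], because the total exponent 1 is
       nonzero. *)
    rewrite -{1}(powRr1 v0) -[1](subrK p) powRD ?subrK ?oner_eq0//.
    rewrite ler_wpM2r ?powR_ge0// ge0_ler_powR ?nnegrE ?subr_ge0 ?(ltW p1)//.
    by rewrite mulr_ge0 ?powR_ge0.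
  have rt0 : 0 < r * t by rewrite mulr_gt0.
  have := Sf _ _ rt0 (subset_trans (closureS sub) clO).
  rewrite -/A => Sfx.
  have intk := @ge0_le_integralZ _ _ _ (@lebesgue_measure_rV R n) _ _
    (fun z => (f z)%:E) (fun z => (f z `^ p)%:E) k k0 sub.
  have -> : c * M `^ (1 - p) = t `^ s * (C / (r * t) `^ A) * k.
    have -> : k = M `^ (1 - p) * (K `^ (s * (1 - p)) / t `^ (s * (1 - p))).
      rewrite /k (powRM _ M0 (powR_ge0 _ _)) -powRrM.
      by rewrite powRM ?invr_ge0 ?(ltW K0) ?(ltW t0)// powRV// ltW.
    rewrite /c (powR_s _ t0) powRM ?(ltW r0) ?(ltW t0)//.
    by field; rewrite !gt_eqF ?powR_gt0.
  rewrite /u EFinM -mulrA [((t `^ s) * _)%:E]EFinM -muleA.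
  rewrite lee_pmul2l ?lte_fin ?powR_gt0//.
  apply: (le_trans Sfx); rewrite [X in (_ <= X * _)%E]EFinM -muleA.
  rewrite lee_pmul2l ?lte_fin ?divr_gt0 ?powR_gt0//.
  apply: intk.
  - by move=> z xz; rewrite lee_fin f0//; exact/DO/sub.
  - by move=> z _; rewrite lee_fin powR_ge0.
  - by move=> z xz; rewrite -EFinM lee_fin f_le.
(* If [M = 0], then [u 0 <= 0] forces [f a = 0], and the left side vanishes. *)
case: (eqVneq M 0) => [M_eq0|M_neq0].
  have := u_le 0 B0.
  rewrite M_eq0 /u dilation0 addr0 pmulr_rle0 ?powR_gt0 ?rho0// => fa.
  have -> : f a = 0.
    by apply/eqP; rewrite eq_le fa f0//; exact: DO.
  rewrite powR0 ?gt_eqF// mule_ge0// lee_fin.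
  by rewrite divr_ge0 ?mulr_ge0 ?powR_ge0// ltW.
have M_gt0 : 0 < M by rewrite lt_def M_neq0.
have cstE : rho 0 `^ (- A) * K `^ (A * ((1 - p) / p)) * C / r `^ A =
    rho 0 `^ (- A) * c.
  by rewrite /c /s [A * _](_ : _ = A / p * (1 - p)); ring.
move: (fun x => u_int x M_gt0) I0; rewrite cstE.
(* If [I] is [+oo], so is the right side; [-oo] contradicts [I0]. For finite [I] the rest takes
   place in the reals. *)
case: I {u_int} => [i||]//= ule; rewrite ?lee_fin => i0; last first.
  rewrite gt0_muley ?leey// lte_fin mulr_gt0// powR_gt0//; exact: rho0.
have {}ule x : B x -> u x <= c * i * M `^ (1 - p).
  by move=> /ule; rewrite lee_fin mulrAC.
have Mp : M `^ p <= c * i.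
  apply: ge0_le_powR_of_le_mul => //; first by rewrite mulr_ge0// ltW.
  apply: ge_sup; first by exists (u 0), 0.
  by move=> _ [x Bx <-]; exact: ule.
rewrite -mulrA powRN mulrC ler_pdivlMr ?powR_gt0 ?rho0//.
apply: le_trans Mp.
have -> : f a `^ p * rho 0 `^ A = u 0 `^ p.
  rewrite /u dilation0 addr0 [RHS]powRM ?powR_ge0//; last exact/f0/DO.
  by rewrite -powRrM /s divfK ?gt_eqF// mulrC.
by rewrite ge0_ler_powR ?nnegrE ?u_ge0 ?u_le// ltW.
Qed.

End mean_value.

Theorem theorem2p8 (R : realType) (n : nat) (B : set 'rV[R]_n)
  (lam : 'I_n -> R) (rho : 'rV[R]_n -> R) (K C p : R)
  (openB : open B) (bndB : bounded_set B) (B0 : B 0)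
  (lam_gt0 : forall i, 0 < lam i)
  (rhoK : radius_function B lam rho K)
  (C_gt0 : 0 < C) (p_gt0 : 0 < p) (p_lt1 : p < 1) :
  (exists2 Cp : R, 0 < Cp & forall (Omega : set 'rV[R]_n) (f : 'rV[R]_n -> R),
     in_S B lam C Omega f -> in_S B lam Cp Omega (fun x => f x `^ p)) /\
  (let A := homogeneous_dim lam in
   let Cp := 2 * rho 0 `^ (- A) * (2 * K `^ A) `^ ((1 - p) / p) * C in
   forall (Omega : set 'rV[R]_n) (f : 'rV[R]_n -> R),
     in_S B lam C Omega f -> in_S B lam Cp Omega (fun x => f x `^ p)).
Proof.
set A := homogeneous_dim lam.
pose Cp := 2 * rho 0 `^ (- A) * (2 * K `^ A) `^ ((1 - p) / p) * C.
have K1 := radius_function_ge1 B0 rhoK; have K0 : 0 < K := lt_le_trans ltr01 K1.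
have q0 : 0 <= (1 - p) / p by rewrite divr_ge0 ?subr_ge0// ltW.
have rho0 : 0 < rho 0 by case: rhoK => _ + _ _ _; exact.
have main Omega f : in_S B lam C Omega f ->
    in_S B lam Cp Omega (fun x => f x `^ p).
  move=> Sf; case: (Sf) => oO mf locf f0 _; split => //.
  - exact: (measurableT_comp (measurable_powR p) mf).
  - move=> x Ox; have [M [_ fM]] := locf x Ox.
    (* [M] may be negative, whereas [|M| + 1] is a nonnegative bound of [f] near [x], to which
       monotonicity of the power applies. *)
    have M1 : M < `|M| + 1 by rewrite (le_lt_trans (ler_norm _))// ltrDl.
    exists ((`|M| + 1) `^ p); split; first exact: num_real.
    move=> N /ltW MN; have := fM _ M1; rewrite /within /=.
    apply: filterS => y fy Oy.
    rewrite /= ger0_norm ?powR_ge0//; apply: le_trans MN.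
    rewrite ge0_ler_powR ?nnegrE ?addr_ge0 ?f0 ?(ltW p_gt0)//.
    exact: le_trans (ler_norm _) (fy Oy).
  - by move=> x _; exact: powR_ge0.
  - move=> a r r0 clO.
    have le_mean := mean_value_powR bndB B0 lam_gt0 rhoK C_gt0 p_gt0 p_lt1 Sf.
    apply: (le_trans (le_mean a r r0 clO)).
    apply: lee_wpmul2r.
      by apply: integral_ge0 => x _; rewrite lee_fin powR_ge0.
    (* With [q = (1 - p) / p], what remains is [K ^ (A q) <= 2 (2 K ^ A) ^ q], which follows from
       [2 ^ q >= 1]. *)
    rewrite lee_fin ler_wpM2r ?invr_ge0 ?powR_ge0// ler_wpM2r ?(ltW C_gt0)//.
    rewrite [2 * _]mulrC -mulrA ler_wpM2l ?powR_ge0//.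
    rewrite powRM ?powR_ge0// -powRrM mulrA ler_peMl ?powR_ge0//.
    have : 1 <= 2 `^ ((1 - p) / p) :> R.
      by rewrite -[leLHS](powRr0 2) ler_powR// ler1n.
    by move=> ?; rewrite -[leLHS]mulr1 ler_pM// ler1n.
split; last exact: main.
by exists Cp => //; rewrite !mulr_gt0 ?powR_gt0// mulr_gt0// powR_gt0.
Qed.
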